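(* Let $f:\mathbb{R}^d\to\mathbb{R}$ be twice differentiable, strictly convex and strongly self-concordant with parameter $M>0$, with minimizer $x_*$. Let $0<\alpha<\beta<1$ with $\alpha<\frac12$. Let $x_0\in\mathbb{R}^d$ be any initial point, $B_0\in\mathbb{S}^d_{++}$ any initial Hessian approximation, and let $\{x_t\}_{t\ge 0}$ be generated by the BFGS method with step sizes satisfying the Armijo–Wolfe conditions with parameters $\alpha,\beta$. Then for every integer $t\ge1$ with $$t\ \ge\ \Psi(\tilde B_0)+3D_0\left(\Psi(\bar B_0)+\frac{3(1+D_0)^2}{\alpha(1-\beta)}\right)$$ we have $$\frac{f(x_t)-f(x_* )}{f(x_0)-f(x_* )}\le\left(1-\frac{2\alpha(1-\beta)}{3}\right)^{t}.$$
   Context: $\mathbb{S}^d_{++}$ is the set of $d\times d$ symmetric positive definite matrices; $A\preceq B$ means $B-A$ is positive semidefinite. Strict convexity means $\nabla^2 f(x)\succ 0$ for all $x$. For $x,u\in\mathbb{R}^d$, $\|u\|_x:=\sqrt{u^\top\nabla^2 f(x)u}$. $f$ is strongly self-concordant with parameter $M>0$ if for all $x,y,z\in\mathbb{R}^d$, $\nabla^2 f(x)-\nabla^2 f(y)\preceq M\|x-y\|_z\nabla^2 f(y)$. $f$ is assumed to have a (unique) minimizer $x_*$. BFGS method: with $g_t=\nabla f(x_t)$, set $d_t=-B_t^{-1}g_t$, $x_{t+1}=x_t+\eta_t d_t$ with $\eta_t>0$, $s_t=x_{t+1}-x_t$, $y_t=\nabla f(x_{t+1})-\nabla f(x_t)$,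 and $B_{t+1}=B_t-\frac{B_ts_ts_t^\top B_t}{s_t^\top B_ts_t}+\frac{y_ty_t^\top}{s_t^\top y_t}$. It is understood that $g_t\ne 0$ along the run, so that everything is well defined. Armijo–Wolfe conditions: $f(x_t+\eta_td_t)\le f(x_t)+\alpha\eta_t\nabla f(x_t)^\top d_t$ and $\nabla f(x_t+\eta_td_t)^\top d_t\ge\beta\nabla f(x_t)^\top d_t$. $\Psi(A):=\mathrm{Tr}(A)-d-\log\det(A)$ for $A\in\mathbb{S}^d_{++}$. $\omega(x):=x-\log(1+x)$, and $\omega^{-1}:[0,\infty)\to[0,\infty)$ is the inverse of $\omega$ restricted to $[0,\infty)$. $C_t:=f(x_t)-f(x_* )$, $D_t:=2\omega^{-1}(M^2C_t/4)$. $\tilde B_0:=\nabla^2 f(x_* )^{-1/2}B_0\nabla^2 f(x_* )^{-1/2}$ and $\bar B_0:=\frac{1}{1+D_0}\tilde B_0$. *)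

(* Defs.v *)
From HB Require Import structures.
From mathcomp Require Import all_boot all_order all_algebra.
From mathcomp Require Import all_classical all_reals all_analysis.
Set Implicit Arguments.
Unset Strict Implicit.
Unset Printing Implicit Defensive.
Import Order.TTheory GRing.Theory Num.Theory numFieldNormedType.Exports.
Local Open Scope classical_set_scope.
Local Open Scope ring_scope.

Section Matrices.
Context {R : realType} {d : nat}.
Implicit Types (A B : 'M[R]_d) (u v : 'cV[R]_d).

Definition dotv u v : R := (u^T *m v) 0 0.
Definition qform A u : R := dotv u (A *m u).

Definition psdmx A : Prop := A^T = A /\ forall u, 0 <= qform A u.
Definition pdmx A : Prop := A^T = A /\ forall u, u != 0 -> 0 < qform A u.
Definition loewner_le A B : Prop := psdmx (B - A).

(* The positive semidefinite square root; 0 if A is not positive semidefinite. *)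
Definition sqrtmx A : 'M[R]_d := xget 0 [set S | psdmx S /\ S *m S = A].
Definition invsqrtmx A : 'M[R]_d := invmx (sqrtmx A).

Definition Psi A : R := \tr A - d%:R - ln (\det A).

End Matrices.

Section Functions.
Context {R : realType} {d : nat}.
Implicit Types (f : 'cV[R]_d -> R) (x u : 'cV[R]_d).

Definition grad f x : 'cV[R]_d := \col_i 'D_(delta_mx i 0) f x.
Definition hess f x : 'M[R]_d :=
  \matrix_(i, j) 'D_(delta_mx i 0) (fun z => 'D_(delta_mx j 0) f z) x.

(* Frechet differentiability of f and of its gradient; 'M[R]_(m, n) carries
   the sup norm, which is equivalent to the Euclidean one. *)
Definition twice_differentiable f : Prop :=
  (forall x, differentiable f x) /\ (forall x, differentiable (grad f) x).

Definition strictly_convex f : Prop := forall x, pdmx (hess f x).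

Definition local_norm f x u : R := Num.sqrt (qform (hess f x) u).

Definition strongly_self_concordant (M : R) f : Prop :=
  forall x y z : 'cV[R]_d,
    loewner_le (hess f x - hess f y) ((M * local_norm f z (x - y)) *: hess f y).

Definition is_minimizer f x : Prop := forall y, f x <= f y.

End Functions.

Section BFGS.
Context {R : realType} {d : nat}.
Implicit Types (f : 'cV[R]_d -> R) (B : 'M[R]_d) (x s y dir : 'cV[R]_d).

Definition bfgs_dir f B x : 'cV[R]_d := - (invmx B *m grad f x).

Definition bfgs_update B s y : 'M[R]_d :=
  B - (qform B s)^-1 *: (B *m s *m s^T *m B) + (dotv s y)^-1 *: (y *m y^T).

Definition bfgs_run f (x : nat -> 'cV[R]_d) (B : nat -> 'M[R]_d)
    (eta : nat -> R) : Prop :=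
  forall t : nat,
    [/\ 0 < eta t,
        x t.+1 = x t + eta t *: bfgs_dir f (B t) (x t) &
        B t.+1 = bfgs_update (B t) (x t.+1 - x t)
                             (grad f (x t.+1) - grad f (x t))].

Definition armijo_wolfe (alpha beta : R) f x dir (eta : R) : Prop :=
  f (x + eta *: dir) <= f x + alpha * eta * dotv (grad f x) dir /\
  dotv (grad f (x + eta *: dir)) dir >= beta * dotv (grad f x) dir.

End BFGS.

Section Omega.
Context {R : realType}.

Definition omega (u : R) : R := u - ln (1 + u).

Definition omega_inv : R -> R := 'pinv_(fun=> 0) `[0, +oo[ omega.

(* D_t, as a function of M and of C_t. *)
Definition Dgap (M C : R) : R := 2 * omega_inv (M ^+ 2 * C / 4).

End Omega.

(* Main.v *)
Require Import Defs.
From HB Require Import structures.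
From mathcomp Require Import all_boot all_order all_algebra.
From mathcomp Require Import all_classical all_reals all_analysis.
From mathcomp Require Import complex ring lra.
Set Implicit Arguments.
Unset Strict Implicit.
Unset Printing Implicit Defensive.
Import Order.TTheory GRing.Theory Num.Theory numFieldNormedType.Exports.
Local Open Scope classical_set_scope.
Local Open Scope ring_scope.

(* Weight everything by [P = hess f xs], and write [C_t], [D_t] as in the
   statement. Comparing second derivatives along the segment from [xs] to [x_t]
   gives [M |x_t - xs|_P <= D_t], so near [x_t] the Hessian of [f] lies between
   [P / (1 + D_t)] and [(1 + D_t) P]. Hence [C_t <= (1 + D_t) / 2 |g_t|^2] and
   [|y_t|^2 <= (1 + D_t) s_t^T y_t], the norms being those of [P^-1].
   With [r_t = (s_t^T B_t s_t)^2 / (|B_t s_t|^2 s_t^T y_t)], the Armijo-Wolfe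
   conditions yield
     [C_{t+1} <= (1 - 2 alpha (1 - beta) r_t / (1 + D_t)) C_t],
   while the trace and the determinant of the BFGS update yield
     [Psi_{t+1} <= Psi_t + |y_t|^2 / s_t^T y_t - 1 + ln r_t],
   so that [sum ln r_i >= - Psi_0 - sum D_i] because [Psi >= 0]. Concavity of
   [v |-> ln (1 - e^v)] turns this lower bound into a linear rate for [C_t].
   The argument is run twice. With the weight [(1 + D_0) P] the terms [D_i]
   disappear from the sum, and the resulting slow rate, together with
   [omega (s u) >= s^2 omega u] for [s <= 1], makes [D_i] decay geometrically
   and [sum D_i] bounded; with the weight [P] and this bound one gets the final
   rate. All integral remainders are replaced by monotonicity of functions on
   [0, 1]. *)

(** * Real symmetric matrices *)

Section Spectral.
Context {R : realType}.

(** Newton interpolation: a new node is fitted by adding a multiple of the product [w], which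
    vanishes at all the earlier ones. *)
Lemma poly_interpolation (F : fieldType) (s : seq F) (g : F -> F) :
  exists q : {poly F}, {in s, forall a, q.[a] = g a}.
Proof.
elim: s => [|a s [q qs]]; first by exists 0.
have [as_|ans] := boolP (a \in s).
  by exists q => b; rewrite inE => /predU1P[->|]; exact: qs.
pose w := \prod_(b <- s) ('X - b%:P).
have wa : w.[a] != 0 by rewrite -rootE root_prod_XsubC.
exists (q + ((g a - q.[a]) / w.[a])%:P * w) => b.
rewrite inE hornerD hornerCM => /predU1P[->|bs]; first by rewrite divfK// addrC subrK.
have /eqP -> : w.[b] == 0 by rewrite -rootE root_prod_XsubC.
by rewrite mulr0 addr0 qs.
Qed.

Lemma dotv_sum n (u v : 'cV[R]_n) : dotv u v = \sum_i u i 0 * v i 0.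
Proof. by rewrite /dotv mxE; apply: eq_bigr => i _; rewrite mxE. Qed.

(** Over [R[i]] a real symmetric matrix is Hermitian, hence normal, and the spectral theorem
    applies; Hermitian symmetry makes the spectrum real. *)
Lemma sym_complex_diag n (A : 'M[R]_n) : A^T = A ->
  exists (P : 'M[R[i]]_n) (lam : 'I_n -> R), P \in unitmx /\
    map_mx (real_complex R) A
      = invmx P *m diag_mx (\row_i (real_complex R (lam i))) *m P.
Proof.
move=> A_sym; set Ac := map_mx _ A.
have Ac_herm : Ac \is hermsymmx.
  apply: realsym_hermsym.
    by apply/is_hermitianmxP; rewrite expr0 scale1r map_mx_id// /Ac map_trmx A_sym.
  by apply/mxOverP => i j; rewrite mxE complex_real.
have /orthomx_spectralP AcE := hermitian_normalmx Ac_herm.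
exists (spectralmx Ac), (fun i => complex.Re (spectral_diag Ac 0 i)).
split; first exact: spectral_unit.
have sp_real := hermitian_spectral_diag_real Ac_herm.
rewrite (_ : \row__ _ = spectral_diag Ac)//; apply/rowP => i; rewrite mxE.
by apply/RRe_real; apply/mxOverP.
Qed.

(** The change of basis is complex, so only facts that descend along the injection of [R] into
    [R[i]] are kept: trace, determinant, and the vanishing of polynomials in [A]. *)
Lemma psdmx_spectral n (A : 'M[R]_n.+1) : psdmx A ->
  exists lam : 'I_n.+1 -> R,
    [/\ forall i, 0 <= lam i, \tr A = \sum_i lam i, \det A = \prod_i lam i
      & forall p : {poly R}, (forall i, p.[lam i] = 0) -> horner_mx A p = 0].
Proof.
move=> [A_sym A_psd]; have [P [lam [P_unit]]] := sym_complex_diag A_sym.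
pose toC : {rmorphism R -> R[i]} := real_complex R.
have toC_inj : injective toC by move=> a b [].
rewrite -/toC; set Ac := map_mx toC A; set sp := \row__ _ => AcE.
have spE i : sp 0 i = toC (lam i) by rewrite mxE.
have PA : P *m Ac = diag_mx sp *m P by rewrite AcE -mulmxA mulKVmx.
clearbody sp.
exists lam; split.
- move=> i.
  (* A row of [P] is a complex eigenvector. Being an eigenvalue descends to [A] itself, which yields
     a real eigenvector on which to test positivity. *)
  have : eigenvalue Ac (toC (lam i)).
    apply/eigenvalueP; exists (row i P).
      rewrite -row_mul PA mul_diag_mx; apply/rowP => j; by rewrite !mxE spE.
    apply/negP => /eqP; rewrite rowE => /(congr1 (mulmx^~ (invmx P))) /=.
    rewrite mulmxK// mul0mx => /rowP/(_ i); rewrite !mxE !eqxx => /eqP.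
    by rewrite oner_eq0.
  rewrite eigenvalue_map => /eigenvalueP[v vA v0].
  have vv : 0 < dotv v^T v^T.
    rewrite lt_def dotv_sum sumr_ge0 => [|j _]; last by rewrite -expr2 sqr_ge0.
    rewrite andbT psumr_neq0 => [|j _]; last by rewrite -expr2 sqr_ge0.
    apply/hasP => /=; case/rV0Pn : v0 => j vj; exists j; first by rewrite mem_index_enum.
    by rewrite !mxE -expr2 lt_def sqrf_eq0 vj sqr_ge0.
  have := A_psd v^T; rewrite /qform {1}/dotv trmxK mulmxA vA -scalemxAl mxE.
  by rewrite pmulr_lge0// -[X in X *m _]trmxK.
- apply: toC_inj; rewrite -(trace_map_mx toC) rmorph_sum.
  rewrite -/Ac AcE mxtrace_mulC mulmxA mulmxV// mul1mx mxtrace_diag.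
  by apply: eq_bigr => i _; rewrite spE.
- apply: toC_inj; rewrite -(det_map_mx toC) rmorph_prod.
  rewrite -/Ac AcE !det_mulmx mulrAC -det_mulmx mulVmx// det1 mul1r det_diag.
  by apply: eq_bigr => i _; rewrite spE.
- move=> p p0; apply: (map_mx_inj (f := toC)) => //=; rewrite map_mx0.
  rewrite map_horner_mx -/Ac AcE horner_mx_uconjC// horner_mx_diag.
  have -> : map_mx (horner (map_poly toC p)) sp = 0.
    by apply/rowP => i; rewrite !mxE spE horner_map p0 rmorph0.
  by rewrite linear0 mulmx0 mul0mx.
Qed.

Lemma pdmx_psdmx n (A : 'M[R]_n) : pdmx A -> psdmx A.
Proof.
move=> [As Ap]; split=> // u; have [->|/Ap/ltW//] := eqVneq u 0.
by rewrite /qform /dotv !mulmx0 mxE.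
Qed.

Lemma pdmx_unitmx n (A : 'M[R]_n) : pdmx A -> A \in unitmx.
Proof.
move=> [As Ap]; rewrite unitmxE unitfE; apply/negP => /det0P[v v0 vA].
have := Ap v^T; rewrite trmx_eq0 => /(_ v0).
by rewrite /qform /dotv mulmxA trmxK vA mul0mx mxE ltxx.
Qed.

Lemma tr_horner_mx n (A : 'M[R]_n.+1) p : (horner_mx A p)^T = horner_mx A^T p.
Proof.
elim/poly_ind: p => [|p c IH]; first by rewrite !rmorph0 trmx0.
rewrite {1}[p * _]mulrC !rmorphD !rmorphM/= !horner_mx_X !horner_mx_C.
by rewrite linearD/= tr_scalar_mx trmx_mul IH.
Qed.

(* The root is [q(A)^2], where [q] interpolates the fourth root on the spectrum:
   being a polynomial in [A] it is real and symmetric, and a square is positive. *)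
Lemma psdmx_sqrt n (A : 'M[R]_n.+1) : psdmx A -> exists S, psdmx S /\ S *m S = A.
Proof.
move=> A_psd; have [lam [lam_ge0 _ _ lamP]] := psdmx_spectral A_psd.
have [q qE] := poly_interpolation [seq lam i | i <- enum 'I_n.+1]
  (fun a => Num.sqrt (Num.sqrt a)).
have qlam i : q.[lam i] = Num.sqrt (Num.sqrt (lam i)).
  by apply: qE; apply: map_f; rewrite mem_enum.
have qT : (horner_mx A q)^T = horner_mx A q by rewrite tr_horner_mx A_psd.1.
exists (horner_mx A q *m horner_mx A q); split.
  split; first by rewrite trmx_mul qT.
  move=> u; rewrite /qform -mulmxA {1}/dotv mulmxA -{1}qT -trmx_mul.
  rewrite -/(dotv _ _) dotv_sum; apply: sumr_ge0 => i _.
  by rewrite -expr2 sqr_ge0.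
have : horner_mx A (q ^+ 4 - 'X) = 0.
  apply: lamP => i; rewrite !hornerE qlam.
  by rewrite -[4%N]/(2 * 2)%N exprM !sqr_sqrtr ?sqrtr_ge0// subrr.
rewrite rmorphB rmorphXn/= horner_mx_X => /eqP; rewrite subr_eq0 => /eqP AE.
by rewrite -[RHS]AE !exprS expr0 mulr1 !mulmxE !mulrA.
Qed.

(** [Psi A] is the sum of [lam - 1 - ln lam] over the spectrum. After exponentiation, the claim is
    the product of the inequalities [lam <= exp (lam - 1)]. *)
Lemma pdmx_Psi n (A : 'M[R]_n.+1) : pdmx A -> 0 < \det A /\ 0 <= Psi A.
Proof.
move=> Ap; have [lam [lam_ge0 trA detA _]] := psdmx_spectral (pdmx_psdmx Ap).
have det_gt0 : 0 < \det A.
  rewrite lt_def; have := pdmx_unitmx Ap; rewrite unitmxE unitfE => ->.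
  by rewrite detA prodr_ge0.
split=> //; rewrite /Psi subr_ge0.
rewrite -[leRHS]expRK ler_ln ?posrE ?expR_gt0//.
have -> : \tr A - n.+1%:R = \sum_(i < n.+1) (lam i - 1).
  by rewrite trA sumrB sumr_const card_ord.
rewrite expR_sum detA; apply: ler_prod => i _; rewrite lam_ge0/=.
by have := expR_ge1Dx (lam i - 1); rewrite addrC subrK.
Qed.

Lemma sqrtmxP n (A : 'M[R]_n.+1) : psdmx A ->
  psdmx (sqrtmx A) /\ sqrtmx A *m sqrtmx A = A.
Proof.
move=> /psdmx_sqrt SE; rewrite /sqrtmx; exact: (xgetPex 0 SE).
Qed.

Lemma invsqrtmxP n (A : 'M[R]_n.+1) : pdmx A ->
  [/\ invsqrtmx A \in unitmx, (invsqrtmx A)^T = invsqrtmx A &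
      invsqrtmx A *m invsqrtmx A = invmx A].
Proof.
move=> Ap; have [[ST _] SS] := sqrtmxP (pdmx_psdmx Ap).
have := pdmx_unitmx Ap; rewrite -{1}SS unitmx_mul => /andP[Su _].
rewrite /invsqrtmx unitmx_inv Su trmx_inv ST; split=> //.
apply: (can_inj (mulmxK (pdmx_unitmx Ap))); rewrite mulVmx ?pdmx_unitmx//.
move: SS Su; move: (sqrtmx A) => S <- Su.
by rewrite -mulmxA mulKmx// mulVmx.
Qed.
End Spectral.

(** * Quadratic forms, and determinant and positivity of the BFGS update *)

Section LinearAlgebra.
Context {R : realType} {d : nat}.
Implicit Types (A B : 'M[R]_d) (u v w s y : 'cV[R]_d) (a : R).

Lemma dotvC u v : dotv u v = dotv v u.
Proof. by rewrite !dotv_sum; apply: eq_bigr => i _; rewrite mulrC. Qed.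

Lemma dotvDl u v w : dotv (u + v) w = dotv u w + dotv v w.
Proof. by rewrite /dotv linearD/= mulmxDl mxE. Qed.

Lemma dotvDr u v w : dotv w (u + v) = dotv w u + dotv w v.
Proof. by rewrite /dotv mulmxDr mxE. Qed.

Lemma dotvZl a u v : dotv (a *: u) v = a * dotv u v.
Proof. by rewrite /dotv linearZ/= -scalemxAl mxE. Qed.

Lemma dotvZr a u v : dotv u (a *: v) = a * dotv u v.
Proof. by rewrite /dotv -scalemxAr mxE. Qed.

Lemma dotvNl u v : dotv (- u) v = - dotv u v.
Proof. by rewrite -scaleN1r dotvZl mulN1r. Qed.

Lemma dotvNr u v : dotv u (- v) = - dotv u v.
Proof. by rewrite -scaleN1r dotvZr mulN1r. Qed.

Lemma dot0v u : dotv 0 u = 0.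
Proof. by rewrite /dotv trmx0 mul0mx mxE. Qed.

Lemma dotv0 u : dotv u 0 = 0.
Proof. by rewrite dotvC dot0v. Qed.

Lemma dotv_mulmxl A u v : dotv (A *m u) v = dotv u (A^T *m v).
Proof. by rewrite /dotv trmx_mul mulmxA. Qed.

Lemma mxtrace_outer u v : \tr (u *m v^T) = dotv u v.
Proof. by rewrite mxtrace_mulC /mxtrace big_ord1 -/(dotv v u) dotvC. Qed.

Lemma qformD A u v : A^T = A ->
  qform A (u + v) = qform A u + 2 * dotv u (A *m v) + qform A v.
Proof.
move=> AT; rewrite /qform mulmxDr dotvDl !dotvDr.
have -> : dotv v (A *m u) = dotv u (A *m v) by rewrite [RHS]dotvC dotv_mulmxl AT.
ring.
Qed.

Lemma qformZ A a u : qform A (a *: u) = a ^+ 2 * qform A u.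
Proof. by rewrite /qform -scalemxAr dotvZl dotvZr mulrA. Qed.

Lemma qformN A u : qform A (- u) = qform A u.
Proof. by rewrite -scaleN1r qformZ sqrrN expr1n mul1r. Qed.

Lemma qform_mxD A B u : qform (A + B) u = qform A u + qform B u.
Proof. by rewrite /qform mulmxDl dotvDr. Qed.

Lemma qform_mxZ A a u : qform (a *: A) u = a * qform A u.
Proof. by rewrite /qform -scalemxAl dotvZr. Qed.

Lemma qform_mxB A B u : qform (A - B) u = qform A u - qform B u.
Proof. by rewrite qform_mxD -scaleN1r qform_mxZ mulN1r. Qed.

Lemma pd_qform_ge0 A : pdmx A -> forall u, 0 <= qform A u.
Proof. by move=> /pdmx_psdmx[]. Qed.

Lemma pdmx_inv A : pdmx A -> pdmx (invmx A).
Proof.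
move=> Ap; have Au := pdmx_unitmx Ap; split; first by rewrite trmx_inv Ap.1.
move=> u u0; have := Ap.2 (invmx A *m u); rewrite /qform mulKVmx//.
rewrite dotvC; apply; apply: contraNneq u0 => /(congr1 (mulmx A)).
by rewrite mulKVmx// mulmx0 => ->.
Qed.

Lemma pdmx_conj (T A : 'M[R]_d) : T \in unitmx -> pdmx A -> pdmx (T^T *m A *m T).
Proof.
move=> Tu [As Ap]; split; first by rewrite !trmx_mul trmxK As mulmxA.
move=> u u0; rewrite /qform -!mulmxA -dotv_mulmxl; apply: Ap.
apply: contraNneq u0 => /(congr1 (mulmx (invmx T))).
by rewrite mulKmx// mulmx0 => ->.
Qed.

Lemma pdmxZ a A : 0 < a -> pdmx A -> pdmx (a *: A).
Proof.
move=> a0 [As Ap]; split; first by rewrite linearZ/= As.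
by move=> u u0; rewrite qform_mxZ mulr_gt0// Ap.
Qed.

Lemma pdmx1 m : pdmx (1%:M : 'M[R]_m).
Proof.
split; first exact: trmx1.
move=> u u0; rewrite /qform mul1mx dotv_sum lt_def psumr_neq0; last first.
  by move=> i _; rewrite -expr2 sqr_ge0.
rewrite sumr_ge0 ?andbT => [|i _]; last by rewrite -expr2 sqr_ge0.
have /cV0Pn[i ui] := u0; apply/hasP; exists i; first by rewrite mem_index_enum.
by rewrite /= -expr2 lt_def sqrf_eq0 ui sqr_ge0.
Qed.

(** Sylvester's determinant identity: the block matrix with rows [1, -U] and [V, 1] factors into
    block triangular matrices in two ways. *)
Lemma detD1M m n (U : 'M[R]_(m, n)) (V : 'M[R]_(n, m)) :
  \det (1%:M + U *m V) = \det (1%:M + V *m U).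
Proof.
have E1 : block_mx 1%:M (- U) V 1%:M =
  block_mx 1%:M 0 V 1%:M *m block_mx 1%:M (- U) 0 (1%:M + V *m U).
  rewrite mulmx_block !mul1mx !mul0mx !mulmx1 !addr0 mulmxN.
  by rewrite addrCA addNr addr0.
have E2 : block_mx 1%:M (- U) V 1%:M =
  block_mx 1%:M (- U) 0 1%:M *m block_mx (1%:M + U *m V) 0 V 1%:M.
  rewrite mulmx_block !mul1mx !mul0mx !mulmx1 !add0r mulNmx.
  by rewrite -addrA subrr addr0.
have := congr1 determinant E2; rewrite E1 !det_mulmx !det_ublock !det_lblock !det1.
by rewrite !mul1r !mulr1.
Qed.

(** The update is [B (1 + U V)] with [U V] of rank at most two, so Sylvester's identity reduces the
    claim to a 2 by 2 determinant. *)
Lemma det_bfgs_update B s y : B \in unitmx -> B^T = B ->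
  qform B s != 0 -> dotv s y != 0 ->
  \det (bfgs_update B s y) = \det B * (dotv s y / qform B s).
Proof.
move=> Bu BT sBs0 sy0.
pose U := row_mx (- (qform B s)^-1 *: s) ((dotv s y)^-1 *: (invmx B *m y)).
pose V := col_mx (B *m s)^T y^T.
have -> : bfgs_update B s y = B *m (1%:M + U *m V).
  rewrite /bfgs_update mul_row_col mulmxDr mulmx1 mulmxDr addrA; congr (_ + _ + _).
    by rewrite scaleNr mulNmx mulmxN -!scalemxAl -scalemxAr trmx_mul BT !mulmxA.
  by rewrite -!scalemxAl -scalemxAr !mulmxA mulmxV// mul1mx.
rewrite det_mulmx detD1M; congr (_ * _).
have VU : V *m U = block_mx (- 1%:M) 1%:M
   (- (dotv s y / qform B s))%:M (dotv y (invmx B *m y) / dotv s y)%:M.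
  rewrite mul_col_row; congr block_mx; apply/matrixP => i j; rewrite !ord1.
  - rewrite -scalemxAr mxE -/(dotv _ _) -dotvC -/(qform B s) !mxE eqxx mulr1n.
    by rewrite mulNr mulVf.
  - rewrite -scalemxAr mxE -/(dotv _ _) dotv_mulmxl BT mulKVmx// mxE eqxx mulr1n.
    by rewrite mulVf.
  - by rewrite -scalemxAr mxE -/(dotv _ _) !mxE eqxx mulr1n mulNr mulrC dotvC.
  - by rewrite -scalemxAr mxE -/(dotv _ _) !mxE eqxx mulr1n mulrC.
rewrite VU (_ : 1%:M = block_mx 1%:M 0 0 1%:M); last by rewrite -scalar_mx_block.
rewrite add_block_mx subrr add0r add0r.
set k := dotv s y / qform B s; set e := dotv y _ / _.
(* Row operations bring the matrix to triangular form with diagonal [k, 1]; the entry [e] drops out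
   of the determinant. *)
have -> : block_mx (0 : 'M[R]_1) 1%:M (- k)%:M (1%:M + e%:M) =
   block_mx 1%:M 1%:M 0 1%:M *m
     (block_mx 1%:M 0 (- 1%:M) 1%:M *m block_mx k%:M (- e%:M) 0 1%:M).
  rewrite !mulmx_block ?(mulmx0, mul0mx, mul1mx, mulmx1, addr0, add0r).
  by rewrite !mulNmx !mul1mx opprK subrr addKr raddfN [e%:M + _]addrC.
by rewrite !det_mulmx !det_ublock !det_lblock !det1 !mul1r mulr1 det_scalar1.
Qed.

Lemma qform_outer u v : qform (v *m v^T) u = dotv v u ^+ 2.
Proof. 
rewrite /qform -mulmxA [v^T *m u]mx11_scalar -/(dotv v u) mul_mx_scalar.
by rewrite dotvZr dotvC expr2.
 Qed.

Lemma qform_bfgs_update B s y u : B^T = B ->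
  qform (bfgs_update B s y) u =
  qform B u - dotv (B *m s) u ^+ 2 / qform B s + dotv y u ^+ 2 / dotv s y.
Proof.
move=> BT; rewrite /bfgs_update qform_mxD qform_mxB !qform_mxZ qform_outer.
have -> : B *m s *m s^T *m B = (B *m s) *m (B *m s)^T by rewrite trmx_mul BT mulmxA.
by rewrite qform_outer ![_^-1 * _]mulrC.
Qed.

(** The part coming from [B] is the form of [B] at the component of [u] that is [B]-orthogonal to
    [s]. It vanishes only for [u] along [s], where the [y] term is positive. *)
Lemma pdmx_bfgs_update B s y : pdmx B -> s != 0 -> 0 < dotv s y ->
  pdmx (bfgs_update B s y).
Proof.
move=> Bp s0 sy0; have [BT Bq] := Bp; have sBs := Bq _ s0; split.
  rewrite /bfgs_update raddfD raddfB/= !linearZ/= !trmx_mul !trmxK BT.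
  by rewrite !mulmxA.
move=> u u0; rewrite qform_bfgs_update//.
set c := dotv (B *m s) u / qform B s.
have cE : c * qform B s = dotv (B *m s) u by rewrite divfK// gt_eqF.
have -> : qform B u - dotv (B *m s) u ^+ 2 / qform B s = qform B (u - c *: s).
  rewrite qformD// qformN qformZ mulmxN dotvNr -scalemxAr dotvZr [dotv u _]dotvC.
  rewrite -cE; field; by rewrite gt_eqF.
have [uE|uc] := eqVneq (u - c *: s) 0; last first.
  by rewrite ltr_wpDr ?Bq// divr_ge0 ?sqr_ge0// ltW.
have {}uE : u = c *: s by apply/eqP; rewrite -subr_eq0 uE.
rewrite uE subrr /qform mulmx0 dotv0 add0r divr_gt0// dotvZr (dotvC y).
rewrite exprn_even_gt0//= mulf_neq0//; last by rewrite gt_eqF.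
by apply: contraNneq u0 => c0; rewrite uE c0 scale0r.
Qed.

End LinearAlgebra.

(** * The potential [Psi] along one BFGS update *)

Section PsiUpdate.
Context {R : realType} {n : nat}.
Implicit Types (B T : 'M[R]_n.+1) (s y : 'cV[R]_n.+1) (c : R).

Lemma mxtrace_conj_outer T v : T^T = T -> \tr (T *m (v *m v^T) *m T) = qform (T *m T) v.
Proof. by move=> TT; rewrite mxtrace_mulC !mulmxA mxtrace_outer dotvC. Qed.

Lemma pdmx_scaled_conj T B c : T \in unitmx -> T^T = T -> 0 < c -> pdmx B ->
  pdmx (c *: (T *m B *m T)).
Proof. by move=> Tu TT c0 Bp; apply: pdmxZ => //; rewrite -{1}TT; exact: pdmx_conj. Qed.

(** The trace loses [k = c |B s|^2 / s^T B s] and gains the [y] term, and the determinant is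
    multiplied by [s^T y / s^T B s]. The inequality [1 + ln k <= k] then trades the loss [k] for a
    logarithm. *)
Lemma Psi_bfgs_update T B c s y : T \in unitmx -> T^T = T -> 0 < c ->
    pdmx B -> s != 0 -> 0 < dotv s y ->
  Psi (c *: (T *m bfgs_update B s y *m T)) <=
    Psi (c *: (T *m B *m T)) + c * qform (T *m T) y / dotv s y - 1
    + ln (qform B s ^+ 2 / (qform (T *m T) (B *m s) * dotv s y) / c).
Proof.
move=> Tu TT c0 Bp s0 sy0.
have sBs : 0 < qform B s by exact: Bp.2.
have Bs0 : B *m s != 0.
  apply: contraNneq s0 => /(congr1 (mulmx (invmx B))).
  by rewrite mulKmx ?pdmx_unitmx// mulmx0 => ->.
have WBs : 0 < qform (T *m T) (B *m s).
  have := pdmx_conj Tu (pdmx1 n.+1); rewrite mulmx1 TT => -[_]; exact.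
have [] := pdmx_Psi (pdmx_scaled_conj Tu TT c0 Bp).
set d0 := \det _ => d0_gt0 _.
have detE : \det (c *: (T *m bfgs_update B s y *m T)) = d0 * (dotv s y / qform B s).
  rewrite /d0 !detZ !det_mulmx det_bfgs_update ?pdmx_unitmx ?gt_eqF// ?Bp.1//.
  by ring.
have trE : \tr (c *: (T *m bfgs_update B s y *m T)) = \tr (c *: (T *m B *m T))
   - c * qform (T *m T) (B *m s) / qform B s + c * qform (T *m T) y / dotv s y.
  have E : B *m s *m s^T *m B = (B *m s) *m (B *m s)^T by rewrite trmx_mul Bp.1 mulmxA.
  rewrite /bfgs_update E !(mulmxDr, mulmxDl, mulmxN, mulNmx) -!(scalemxAl, scalemxAr).
  rewrite !mxtraceZ mxtraceD raddfB/= !mxtraceZ !mxtrace_conj_outer//.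
  by ring.
rewrite /Psi detE trE -/d0 [ln (d0 * _)]lnM ?posrE ?divr_gt0//.
set k := c * qform (T *m T) (B *m s) / qform B s.
have k0 : 0 < k by rewrite divr_gt0 ?mulr_gt0.
have -> : qform B s ^+ 2 / (qform (T *m T) (B *m s) * dotv s y) / c =
    k^-1 * (dotv s y / qform B s)^-1.
  by rewrite /k; field; rewrite !gt_eqF.
have dk : 0 < dotv s y / qform B s by rewrite divr_gt0.
have -> : ln (k^-1 / (dotv s y / qform B s)) = - ln k - ln (dotv s y / qform B s).
  move: k k0 (dotv s y / _) dk => a a0 b b0.
  by rewrite lnM ?posrE ?invr_gt0// !lnV ?posrE.
have : ln (1 + (k - 1)) <= k - 1 by apply: le_ln1Dx; lra.
rewrite addrC subrK; lra.
Qed.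

End PsiUpdate.

(** * The function omega and its inverse *)

Section RealFunctions.
Context {R : realType}.

Lemma derive_ge0_le (h h1 : R -> R) (a b : R) : a <= b ->
  (forall t, a <= t <= b -> is_derive t 1 h (h1 t)) ->
  (forall t, a <= t <= b -> 0 <= h1 t) -> h a <= h b.
Proof.
move=> ab hd h1_ge0; have [||c] := @MVT_segment R h h1 a b ab.
- by move=> t; rewrite in_itv/= => /andP[/ltW at_ /ltW tb]; apply: hd; rewrite at_.
- by apply: derivable_within_continuous => t; rewrite in_itv/= => /hd[].
rewrite in_itv/= => cab E; rewrite -subr_ge0 E mulr_ge0 ?h1_ge0//.
by rewrite subr_ge0.
Qed.

(** Replaces Taylor's formula with integral remainder: [h t - t h1 0] is nondecreasing because [h1]
    is. *)
Lemma second_order_le (h h1 h2 : R -> R) :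
  (forall t : R, 0 <= t <= 1 -> is_derive t 1 h (h1 t)) ->
  (forall t : R, 0 <= t <= 1 -> is_derive t 1 h1 (h2 t)) ->
  (forall t : R, 0 <= t <= 1 -> 0 <= h2 t) -> h 0 + h1 0 <= h 1.
Proof.
move=> hd h1d h2_ge0.
have : h 0 - 0 * h1 0 <= h 1 - 1 * h1 0; last by lra.
apply: (@derive_ge0_le (fun t => h t - t * h1 0) (fun t => h1 t - h1 0)) => // t t01.
  have := hd t t01 => ?.
  by apply: is_derive_eq; rewrite /GRing.scale/=; ring.
rewrite subr_ge0; have /andP[t0 t1] := t01.
have t01' (u : R) : 0 <= u <= t -> 0 <= u <= 1 by lra.
by apply: (@derive_ge0_le h1 h2) => // u /t01'; [exact: h1d|exact: h2_ge0].
Qed.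

Lemma is_derive_ln1D (c t : R) : 0 < 1 + c * t ->
  is_derive t 1 (fun u => ln (1 + c * u)) (c / (1 + c * t)).
Proof.
move=> ct; have H1 := is_derive1_ln ct.
have H2 : is_derive t 1 (fun u => 1 + c * u) c.
  by apply: is_derive_eq; rewrite /GRing.scale/=; ring.
by have := @is_derive1_comp _ _ (fun u => 1 + c * u) _ _ _ H1 H2; rewrite mulrC.
Qed.

Lemma is_derive_omega (c t : R) : 0 < 1 + c * t ->
  is_derive t 1 (fun u => omega (c * u)) (c - c / (1 + c * t)).
Proof.
move=> ct; have := is_derive_ln1D ct => ?; rewrite /omega.
by apply: is_derive_eq; rewrite /GRing.scale/=; ring.
Qed.

Lemma is_derive2_omega (c t : R) : 0 < 1 + c * t ->
  is_derive t 1 (fun u => c - c / (1 + c * u)) ((c / (1 + c * t)) ^+ 2).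
Proof.
move=> ct.
have H : is_derive t 1 (fun u : R => 1 + c * u) c.
  by apply: is_derive_eq; rewrite /GRing.scale/=; ring.
have H2 := @is_deriveV R (fun u => 1 + c * u) t c 1 (negbT (gt_eqF ct)) H.
apply: is_derive_eq; rewrite /GRing.scale/=.
by field; rewrite gt_eqF.
Qed.

Lemma omega0 : omega 0 = 0 :> R.
Proof. by rewrite /omega addr0 ln1 subrr. Qed.

(** With [1 + v = (1 + u) (1 + w)], the logarithm grows by [ln (1 + w) < w <= v - u]. *)
Lemma omega_lt (u v : R) : 0 <= u -> u < v -> omega u < omega v.
Proof.
move=> u0 uv; rewrite /omega.
have u1 : 0 < 1 + u by lra.
have v1 : 0 < 1 + v by lra.
pose w := (v - u) / (1 + u).
have w0 : 0 < w by rewrite divr_gt0// subr_gt0.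
have vE : 1 + v = (1 + u) * (1 + w) by rewrite /w; field; rewrite gt_eqF.
have lnw : ln (1 + w) < w.
  by rewrite -{2}[w]expRK ltr_ln ?posrE ?expR_gt0 ?expR_gt1Dx ?gt_eqF// ltr_wpDl.
have -> : ln (1 + v) = ln (1 + u) + ln (1 + w) by rewrite vE lnM ?posrE// ltr_wpDl.
have : w <= v - u by rewrite ler_pdivrMr// ler_peMr ?subr_ge0 ?lerDl// ltW.
lra.
Qed.

(** The difference vanishes at [u = 0], and its derivative in [u] is
    [s^2 u^2 (1 - s) / ((1 + s u) (1 + u))]. *)
Lemma sqr_mul_omega_le (s u : R) : 0 <= s <= 1 -> 0 <= u ->
  s ^+ 2 * omega u <= omega (s * u).
Proof.
move=> /andP[s0 s1] u0.
have : omega (s * 0) - s ^+ 2 * omega (1 * 0) <= omega (s * u) - s ^+ 2 * omega (1 * u).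
  apply: (@derive_ge0_le (fun t => omega (s * t) - s ^+ 2 * omega (1 * t))
     (fun t => (s - s / (1 + s * t)) - s ^+ 2 * (1 - 1 / (1 + 1 * t)))
     0 u u0) => t /andP[t0 tu].
    have st : 0 < 1 + s * t by rewrite ltr_wpDr// mulr_ge0.
    have t1 : 0 < 1 + 1 * t by rewrite ltr_wpDr// mulr_ge0.
    have := is_derive_omega st => ?; have := is_derive_omega t1 => ?.
    by apply: is_derive_eq; rewrite /GRing.scale/=; ring.
  have st : 0 < 1 + s * t by rewrite ltr_wpDr// mulr_ge0.
  have t1 : 0 < 1 + t by rewrite ltr_wpDr.
  rewrite !mul1r.
  have -> : s - s / (1 + s * t) - s ^+ 2 * (1 - (1 + t)^-1) =
     s ^+ 2 * t ^+ 2 * (1 - s) / ((1 + s * t) * (1 + t)).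
    by field; rewrite !gt_eqF.
  rewrite divr_ge0// ?mulr_ge0 ?sqr_ge0 ?subr_ge0// ltW//.
rewrite !mulr0 omega0 mulr0 subrr mul1r; lra.
Qed.

Lemma omega_inv_spec (y : R) : 0 <= y -> 0 <= omega_inv y /\ omega (omega_inv y) = y.
Proof.
(* Upper end for the intermediate value theorem: [ln (1 + b) <= ln 2 + (1 + b) / 2 - 1 <= (1 + b) /
   2], so [omega b >= (b - 1) / 2 = y]. *)
move=> y0; pose b := 2 * y + 1.
have bE : b = 2 * y + 1 by [].
have b0 : 0 <= b by rewrite /b; lra.
clearbody b.
have yb : y <= omega b.
  rewrite /omega; have H := @le_ln1Dx R ((1 + b) / 2 - 1).
  have ln2 := @le_ln1Dx R 1.
  have -> : ln (1 + b) = ln (1 + 1) + ln (1 + ((1 + b) / 2 - 1)).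
    by rewrite -lnM ?posrE; [congr ln; field|lra|lra].
  have {}H : ln (1 + ((1 + b) / 2 - 1)) <= (1 + b) / 2 - 1 by apply: H; lra.
  have {}ln2 : ln (1 + 1) <= 1 :> R by apply: ln2; lra.
  lra.
have yim : y \in omega @` `[0, +oo[.
  rewrite inE.
  have [||c] := @IVT R omega 0 b y b0.
  - apply: derivable_within_continuous => t; rewrite in_itv/= => /andP[t0 _].
    have t1 : 0 < 1 + 1 * t by rewrite mul1r ltr_wpDr.
    have [] := is_derive_omega t1.
    by under eq_fun do rewrite mul1r.
  - by rewrite omega0 ge_min y0/= le_max yb orbT.
  rewrite in_itv/= => /andP[c0 _] cy; exists c => //=.
  by rewrite in_itv/= c0.
have inj : {in `[0, +oo[%classic : set R &, injective (omega : R -> R)}.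
  move=> u v; rewrite !inE/= !in_itv/= !andbT => u0 v0 uv.
  by case: (ltgtP u v) => // /omega_lt; [move=> /(_ u0)|move=> /(_ v0)]; rewrite uv ltxx.
split; last by rewrite /omega_inv pinvK.
have := @injpinv_image R R (fun=> 0) `[0, +oo[ omega inj.
move=> /seteqP[H _]; have := H (omega_inv y); rewrite /= in_itv/= andbT; apply.
by exists y => //; rewrite inE in yim.
Qed.

Lemma Dgap_ge0 (M C : R) : 0 <= C -> 0 <= Dgap M C.
Proof.
move=> C0; rewrite /Dgap mulr_ge0//; apply: (omega_inv_spec _).1.
by rewrite divr_ge0// mulr_ge0 ?sqr_ge0.
Qed.

Lemma omega_le_inv (u v : R) : 0 <= u -> 0 <= v -> omega u <= omega v -> u <= v.
Proof. by move=> u0 v0; rewrite !leNgt; apply: contra => /(omega_lt v0). Qed.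

Lemma le_Dgap (M C r : R) : 0 <= r -> 0 <= C -> 4 * omega (r / 2) <= M ^+ 2 * C ->
  r <= Dgap M C.
Proof.
move=> r0 C0 rC; have y0 : 0 <= M ^+ 2 * C / 4 by rewrite divr_ge0// mulr_ge0 ?sqr_ge0.
have [w0 wE] := omega_inv_spec y0.
have : r / 2 <= omega_inv (M ^+ 2 * C / 4).
  apply: omega_le_inv => //; first by rewrite divr_ge0.
  rewrite wE; lra.
rewrite /Dgap; lra.
Qed.

(** Converts a linear rate of the gaps into geometric decay of the [D_t], at half the exponent. *)
Lemma Dgap_scale (M C C' s : R) : 0 <= s <= 1 -> 0 <= C -> 0 <= C' -> C' <= s ^+ 2 * C ->
  Dgap M C' <= s * Dgap M C.
Proof.
move=> s01 C0 C'0 C'C; have /andP[s0 s1] := s01.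
have y0 : 0 <= M ^+ 2 * C / 4 by rewrite divr_ge0// mulr_ge0 ?sqr_ge0.
have y'0 : 0 <= M ^+ 2 * C' / 4 by rewrite divr_ge0// mulr_ge0 ?sqr_ge0.
have [w0 wE] := omega_inv_spec y0; have [w'0 w'E] := omega_inv_spec y'0.
rewrite /Dgap mulrCA ler_pM2l//; apply: omega_le_inv => //; first by rewrite mulr_ge0.
rewrite w'E; apply: le_trans (sqr_mul_omega_le s01 w0); rewrite wE.
by have := ler_wpM2l (sqr_ge0 M) C'C; nra.
Qed.

End RealFunctions.

(** * Derivatives along lines *)

Section LineDerivatives.
Context {R : realType} {d : nat}.
Implicit Types (f : 'cV[R]_d -> R) (x v w : 'cV[R]_d).

Lemma is_derive_line (g : 'cV[R]_d -> R) x v t : differentiable g (x + t *: v) ->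
  is_derive t 1 (fun u : R => g (x + u *: v)) ('D_v g (x + t *: v)).
Proof.
move=> /diff_derivable dg.
have E : (fun h : R => h^-1 *: (((fun u : R => g (x + u *: v)) \o shift t) (h *: 1)
          - g (x + t *: v))) =
  (fun h : R => h^-1 *: ((g \o shift (x + t *: v)) (h *: v) - g (x + t *: v))).
  apply/funext => h /=; congr (_ *: (g _ - _)).
  by rewrite [h%:A]mulr1 scalerDl addrCA.
have dgv := dg v.
by split; rewrite /derivable /derive E.
Qed.

Lemma derive_partials f x v : differentiable f x ->
  'D_v f x = \sum_i v i 0 * 'D_(delta_mx i 0) f x.
Proof.
move=> df; rewrite deriveE// {1}[v]matrix_sum_delta linear_sum.
apply: eq_bigr => i _; rewrite big_ord1 linearZ/= deriveE//.
Qed.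

Lemma is_derive_grad f x v (t : R) : (forall z, differentiable f z) ->
  is_derive t 1 (fun u : R => f (x + u *: v)) (dotv v (grad f (x + t *: v))).
Proof.
move=> df; have := is_derive_line (df (x + t *: v)).
rewrite derive_partials// dotv_sum.
by under [X in _ -> is_derive _ _ _ X]eq_bigr do rewrite mxE.
Qed.

(** The row index of [hess] is that of the outer derivative, so the direction [v] of the line stands
    on the left. *)
Lemma is_derive_hess f x v w (t : R) : (forall z, differentiable (grad f) z) ->
  is_derive t 1 (fun u : R => dotv w (grad f (x + u *: v)))
    (dotv v (hess f (x + t *: v) *m w)).
Proof.
move=> dg.
have dgj j z : differentiable (fun z => 'D_(delta_mx j 0) f z) z.
  have -> : (fun z => 'D_(delta_mx j 0) f z) =
     (fun N : 'cV[R]_d => N j 0 : R) \o grad f by apply/funext => u; rewrite /= mxE.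
  apply: differentiable_comp; first exact: dg.
  exact: differentiable_coord.
have E : (fun u : R => dotv w (grad f (x + u *: v))) =
   \sum_j (fun u : R => w j 0 * 'D_(delta_mx j 0) f (x + u *: v)).
  apply/funext => u; rewrite dotv_sum fct_sumE; apply: eq_bigr => j _.
  by rewrite mxE.
rewrite E.
have -> : dotv v (hess f (x + t *: v) *m w) =
  \sum_j w j 0 * 'D_v (fun z => 'D_(delta_mx j 0) f z) (x + t *: v).
  rewrite dotv_sum.
  under eq_bigr do rewrite mxE mulr_sumr.
  rewrite exchange_big/=; apply: eq_bigr => j _.
  rewrite derive_partials// mulr_sumr; apply: eq_bigr => i _.
  by rewrite mxE; ring.
apply: is_derive_sum => j.
have := is_derive_line (dgj j (x + t *: v)) => ?.
by apply: is_derive_eq; rewrite /GRing.scale/=; ring.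
Qed.

End LineDerivatives.

(** * Strongly self-concordant functions *)

(** Since [1 + 2 a t <= (1 + a t)^2]. Here [q] stands for the Hessian form at time [t] of a segment
    leaving [xs], and [a] for [M r / 2]. *)
Lemma self_concordant_growth (R : realFieldType) (r a t k q : R) :
  0 <= a -> 0 <= t -> k * a ^+ 2 = r ^+ 2 -> r ^+ 2 <= (1 + 2 * (a * t)) * q ->
  0 <= q -> k * (a / (1 + a * t)) ^+ 2 <= q.
Proof.
move=> a0 t0 ka rq q0.
have st : 0 < 1 + a * t by rewrite ltr_wpDr// mulr_ge0.
rewrite expr_div_n mulrA ka ler_pdivrMr ?exprn_gt0//.
apply: (le_trans rq); rewrite mulrC ler_wpM2l//.
have := sqr_ge0 (a * t); lra.
Qed.

Section SelfConcordance.
Context {R : realType} {d : nat}.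
Implicit Types (P : 'M[R]_d) (x y z u v w s : 'cV[R]_d).
Variables (f : 'cV[R]_d -> R) (M : R) (xs : 'cV[R]_d).
Hypothesis f_diff : twice_differentiable f.
Hypothesis f_convex : strictly_convex f.
Hypothesis M_gt0 : 0 < M.
Hypothesis f_ssc : strongly_self_concordant M f.
Hypothesis xs_min : is_minimizer f xs.

Lemma minimizer_grad v : dotv v (grad f xs) = 0.
Proof.
have [] := @derive1_at_min R (fun t : R => f (xs + t *: v)) (- 1) 1 0.
- by lra.
- by move=> t _; have [] := is_derive_grad xs v t f_diff.1.
- by rewrite in_itv/=; lra.
- by move=> t _; rewrite scale0r addr0; exact: xs_min.
move=> _; have [_] := is_derive_grad xs v 0 f_diff.1.
by rewrite scale0r addr0 => -> .
Qed.

Lemma hess_le x y z u :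
  qform (hess f x) u <= (1 + M * local_norm f z (x - y)) * qform (hess f y) u.
Proof.
have := f_ssc x y z; rewrite /loewner_le => -[_ /(_ u)].
rewrite !qform_mxB qform_mxZ mulrDl mul1r subr_ge0 => H.
by rewrite -lerBlDl.
Qed.

Lemma local_normN x u : local_norm f x (- u) = local_norm f x u.
Proof. by rewrite /local_norm qformN. Qed.

Lemma local_normZ x a u : 0 <= a -> local_norm f x (a *: u) = a * local_norm f x u.
Proof.
by move=> a0; rewrite /local_norm qformZ sqrtrM ?sqr_ge0// sqrtr_sqr ger0_norm.
Qed.

Lemma sqr_local_norm x u : local_norm f x u ^+ 2 = qform (hess f x) u.
Proof. by rewrite /local_norm sqr_sqrtr//; exact: (pd_qform_ge0 (f_convex x)). Qed.

(* On the segment, [f] grows at least like [4 / M^2 * omega (M r t / 2)], whose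
   second derivative [r^2 / (1 + M r t / 2)^2] is at most [r^2 / (1 + M r t)]. *)
Lemma local_norm_le_Dgap x : M * local_norm f xs (x - xs) <= Dgap M (f x - f xs).
Proof.
have xE : x = xs + (x - xs) by rewrite addrCA subrr addr0.
move: (x - xs) xE => v xE; move rE : (local_norm f xs v) => r.
have r0 : 0 <= r by rewrite -rE; exact: sqrtr_ge0.
apply: le_Dgap; rewrite ?subr_ge0//; first by rewrite mulr_ge0// ltW.
move aE : (M * r / 2) => a.
have a0 : 0 <= a by rewrite -aE divr_ge0// mulr_ge0// ltW.
have at0 (t : R) : 0 <= t <= 1 -> 0 < 1 + a * t.
  by move=> /andP[t0 _]; rewrite ltr_wpDr// mulr_ge0.
pose k := 4 / M ^+ 2.
have ka : k * a ^+ 2 = r ^+ 2 by rewrite /k -aE; field; rewrite gt_eqF.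
have := @second_order_le R
  (fun t => f (xs + t *: v) - k * omega (a * t))
  (fun t => dotv v (grad f (xs + t *: v)) - k * (a - a / (1 + a * t)))
  (fun t => qform (hess f (xs + t *: v)) v - k * (a / (1 + a * t)) ^+ 2).
rewrite scale0r scale1r addr0 !mulr0 addr0 divr1 subrr mulr0 omega0 mulr0 !subr0.
rewrite minimizer_grad addr0 mulr1 -xE => H.
have {}H : f xs <= f x - k * omega a.
  apply: H => t t01; have st := at0 t t01.
  - have := is_derive_grad xs v t f_diff.1 => ?; have := is_derive_omega st => ?.
    by apply: is_derive_eq; rewrite /GRing.scale/=; ring.
  - have := is_derive_hess xs v v t f_diff.2 => ?; have := is_derive2_omega st => ?.
    by apply: is_derive_eq; rewrite /GRing.scale/= /qform; ring.
  have /andP[t0 _] := t01.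
  have lE : M * local_norm f xs (xs - (xs + t *: v)) = 2 * (a * t).
    have -> : xs - (xs + t *: v) = - (t *: v) by rewrite opprD addrA subrr add0r.
    by rewrite local_normN (local_normZ xs v t0) rE -aE; field.
  rewrite subr_ge0; apply: (self_concordant_growth a0 t0 ka).
    rewrite -rE sqr_local_norm -lE; exact: hess_le.
  exact: (pd_qform_ge0 (f_convex _)).
have -> : 4 * omega a = M ^+ 2 * (k * omega a) by rewrite /k; field; rewrite gt_eqF.
by rewrite ler_pM2l ?exprn_gt0//; lra.
Qed.

(** The difference of the two sides is [t (1 - t)] times the form at [b - a]. *)
Lemma qform_convex (A : 'M[R]_d) (a b : 'cV[R]_d) (t : R) : psdmx A -> 0 <= t <= 1 ->
  qform A (a + t *: (b - a)) <= (1 - t) * qform A a + t * qform A b.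
Proof.
move=> [AT Aq] /andP[t0 t1].
have H := Aq (b - a); rewrite -subr_ge0.
have -> : qform A b = qform A a + 2 * dotv a (A *m (b - a)) + qform A (b - a).
  by rewrite -qformD// [a + _]addrC subrK.
rewrite (qformD a (t *: (b - a)) AT) qformZ -scalemxAr dotvZr.
set e := qform A (b - a) in H *; set g := dotv _ _.
have -> : (1 - t) * qform A a + t * (qform A a + 2 * g + e) -
  (qform A a + 2 * (t * g) + t ^+ 2 * e) = t * (1 - t) * e by ring.
by rewrite !mulr_ge0// subr_ge0.
Qed.

(** Balls around [xs] are convex, so Hessian bounds valid at two points of a ball hold on the
    segment between them. *)
Lemma local_norm_segment (a b : 'cV[R]_d) (t D : R) : 0 <= t <= 1 ->
  M * local_norm f xs (a - xs) <= D -> M * local_norm f xs (b - xs) <= D ->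
  M * local_norm f xs (a + t *: (b - a) - xs) <= D.
Proof.
move=> t01; rewrite -!(ler_pdivlMl _ _ M_gt0); set c := M^-1 * D => aD bD.
have c0 : 0 <= c by apply: le_trans aD; exact: sqrtr_ge0.
rewrite -(ler_pXn2r (n := 2)) ?nnegrE ?sqrtr_ge0// sqr_local_norm.
have -> : a + t *: (b - a) - xs = (a - xs) + t *: ((b - xs) - (a - xs)).
  by rewrite opprB addrA subrK addrAC.
apply: le_trans (qform_convex _ _ (pdmx_psdmx (f_convex xs)) t01) _.
move: aD bD; rewrite -(ler_pXn2r (n := 2)) ?nnegrE ?sqrtr_ge0// sqr_local_norm => aD.
rewrite -(ler_pXn2r (n := 2)) ?nnegrE ?sqrtr_ge0// sqr_local_norm => bD.
have /andP[t0 t1] := t01.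
have t1' : 0 <= 1 - t by rewrite subr_ge0.
by have := ler_wpM2l t0 bD; have := ler_wpM2l t1' aD; lra.
Qed.

(** Strong self-concordance leaves the point of the norm free. Taking [xs] both here and in
    [hess_ge_min] bounds both comparisons by the same radius. *)
Lemma hess_le_min z D u : M * local_norm f xs (z - xs) <= D ->
  qform (hess f z) u <= (1 + D) * qform (hess f xs) u.
Proof.
move=> zD; apply: le_trans (hess_le z xs xs u) _; rewrite ler_wpM2r//.
  exact: (pd_qform_ge0 (f_convex _)).
by rewrite lerD2l.
Qed.

Lemma hess_ge_min z D u : M * local_norm f xs (z - xs) <= D ->
  qform (hess f xs) u <= (1 + D) * qform (hess f z) u.
Proof.
move=> zD; apply: le_trans (hess_le xs z xs u) _; rewrite ler_wpM2r//.
  exact: (pd_qform_ge0 (f_convex _)).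
rewrite lerD2l.
have -> : xs - z = - (z - xs).
by rewrite opprB.
rewrite local_normN.
exact: zD.
Qed.

(** Towards [xs] the second derivative of [f] is at least [q / L], so
    [f xs >= f x + v^T g + q / (2 L)]; the right-hand side is then minimized over all [v]. *)
Lemma gap_le_grad P x (L : R) : pdmx P -> 0 < L ->
  (forall (t : R) u, 0 <= t <= 1 ->
     qform P u <= L * qform (hess f (x + t *: (xs - x))) u) ->
  f x - f xs <= L / 2 * qform (invmx P) (grad f x).
Proof.
move=> P_pd L0 HL; set v := xs - x; set g := grad f x; set q := qform P v.
have Pu := pdmx_unitmx P_pd.
have := @second_order_le R
  (fun t => f (x + t *: v) - q / (2 * L) * (t * t))
  (fun t => dotv v (grad f (x + t *: v)) - q / L * t)
  (fun t => qform (hess f (x + t *: v)) v - q / L).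
rewrite scale0r scale1r addr0 !mulr0 !subr0 !mulr1 [x + v]addrCA subrr addr0 -/g => H.
have {}H : f x + dotv v g <= f xs - q / (2 * L).
  apply: H => t t01.
  - have := is_derive_grad x v t f_diff.1 => ?.
    by apply: is_derive_eq; rewrite /GRing.scale/=; field; rewrite gt_eqF.
  - have := is_derive_hess x v v t f_diff.2 => ?.
    by apply: is_derive_eq; rewrite /GRing.scale/=; rewrite /qform; ring.
  by rewrite subr_ge0 ler_pdivrMr// mulrC HL.
(* Completing the square: the minimum over [v] is at [- L P^-1 g]. *)
have := pd_qform_ge0 P_pd (v + L *: (invmx P *m g)).
rewrite qformD ?P_pd.1// qformZ -scalemxAr dotvZr mulKVmx// -/q.
have -> : qform P (invmx P *m g) = qform (invmx P) g.
  by rewrite /qform mulKVmx// dotvC.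
set G := qform _ g => G0.
have {}G0 : 0 <= (q + 2 * (L * dotv v g) + L ^+ 2 * G) / (2 * L).
  by rewrite divr_ge0// mulr_ge0// ltW.
suff : (q + 2 * (L * dotv v g) + L ^+ 2 * G) / (2 * L) =
   q / (2 * L) + dotv v g + L / 2 * G by lra.
by field; rewrite gt_eqF.
Qed.

(* With [w = P^-1 y], the nonnegative form [hess f] at [s - w / L] bounds from
   below the derivative along the segment of [(s - 2 w / L)^T grad f]. *)
Lemma grad_diff_le P x s (L : R) : pdmx P -> 0 < L ->
  (forall (t : R) u, 0 <= t <= 1 ->
     qform (hess f (x + t *: s)) u <= L * qform P u) ->
  qform (invmx P) (grad f (x + s) - grad f x)
    <= L * dotv s (grad f (x + s) - grad f x).
Proof.
move=> P_pd L0 HL; set y := grad f (x + s) - grad f x; have Pu := pdmx_unitmx P_pd.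
set w := invmx P *m y; set N := qform (invmx P) y; pose c := L^-1.
have NE : dotv w y = N by rewrite dotvC.
have Nw : qform P w = N by rewrite /qform mulKVmx.
have := @derive_ge0_le R
  (fun t => dotv (s - (2 * c) *: w) (grad f (x + t *: s)) + c * N * t)
  (fun t => dotv s (hess f (x + t *: s) *m (s - (2 * c) *: w)) + c * N) 0 1 ler01.
rewrite scale0r scale1r addr0 mulr0 addr0 mulr1 => H.
have {}H : dotv (s - (2 * c) *: w) (grad f x) <=
    dotv (s - (2 * c) *: w) (grad f (x + s)) + c * N.
  apply: H => t t01.
    have := is_derive_hess x s (s - (2 * c) *: w) t f_diff.2 => ?.
    by apply: is_derive_eq; rewrite /GRing.scale/=; ring.
  have Hp := f_convex (x + t *: s).
  have := HL t w t01; rewrite Nw.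
  have := pd_qform_ge0 Hp (s - c *: w).
  rewrite qformD ?Hp.1// qformN qformZ mulmxN dotvNr -scalemxAr dotvZr.
  rewrite mulmxBr dotvDr dotvNr -scalemxAr dotvZr -/(qform _ s).
  set h := dotv s _; set qs := qform _ s; set qw := qform _ w => H1 H2.
  have : c ^+ 2 * qw <= c ^+ 2 * (L * N) by rewrite ler_wpM2l ?sqr_ge0.
  have -> : c ^+ 2 * (L * N) = c * N by rewrite /c; field; rewrite gt_eqF.
  lra.
have : 0 <= dotv (s - (2 * c) *: w) y + c * N.
  by move: H; rewrite /y dotvDr dotvNr; lra.
rewrite dotvDl dotvNl dotvZl NE => H2.
have : c * N <= dotv s y by lra.
by rewrite /c mulrC ler_pdivrMr// mulrC.
Qed.

End SelfConcordance.

(** * Convergence of BFGS *)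

Section Scalars.
Context {R : realType}.
Implicit Types (C k a : nat -> R) (rho K : R).

(** Source of the 3 in the rates: a sum of [t] logarithms that falls short by at most [t] is still
    at least [- t ln 3]. The proof is [e^(-1) >= (5/6)^6 >= 1/3]. *)
Lemma ln3_ge1 : 1 <= ln 3 :> R.
Proof.
have e6 : 5 / 6 <= expR (- (1 / 6)) :> R.
  by have := expR_ge1Dx (- (1 / 6) : R); lra.
have e1 : (5 / 6) ^+ 6 <= expR (- 1) :> R.
  have -> : expR (- 1) = expR (- (1 / 6)) ^+ 6 :> R.
    by rewrite -expRM_natl; congr expR; field.
  by rewrite lerXn2r ?nnegrE ?expR_ge0//; lra.
have e3 : expR 1 <= 3 :> R.
  have := expR_gt0 (1 : R); rewrite expRN in e1.
  move: e1; set e := expR 1 => e1 e0.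
  have : (5 / 6) ^+ 6 * e <= 1 by rewrite -ler_pdivlMr// div1r.
  (* The detour through [26 / 45] avoids the unary numeral [5 ^ 6]. *)
  have c3 : 26 / 45 <= (5 / 6 : R) ^+ 3 by lra.
  have : (26 / 45 : R) ^+ 2 <= ((5 / 6) ^+ 3) ^+ 2.
    by rewrite lerXn2r ?nnegrE ?exprn_ge0//; lra.
  rewrite -exprM -[(3 * 2)%N]/6%N; set c6 := (5 / 6) ^+ 6 => c6_ge H.
  have : 1 / 3 * e <= c6 * e by rewrite ler_wpM2r ?(ltW e0)//; lra.
  lra.
by rewrite -[leLHS]expRK ler_ln ?posrE ?expR_gt0.
Qed.

(* The tangent line of the concave function [v |-> ln (1 - e^v)] at [ln rho]. *)
Lemma ln1B_le (kap rho : R) : 0 < kap < 1 -> 0 < rho < 1 ->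
  ln (1 - kap) <= ln (1 - rho) - rho / (1 - rho) * (ln kap - ln rho).
Proof.
move=> /andP[k0 k1] /andP[r0 r1].
have k1' : 0 < 1 - kap by lra.
have r1' : 0 < 1 - rho by lra.
have lnB (a b : R) : 0 < a -> 0 < b -> ln a - ln b <= a / b - 1.
  move=> a0 b0; rewrite -ln_div ?posrE//.
  have : ln (1 + (a / b - 1)) <= a / b - 1.
    by apply: le_ln1Dx; rewrite ltrBrDr addNr divr_gt0.
  by rewrite [1 + _]addrC subrK.
have H1 := lnB _ _ k0 r0; have H2 := lnB _ _ k1' r1'.
have : rho / (1 - rho) * (ln kap - ln rho) <= rho / (1 - rho) * (kap / rho - 1).
  by rewrite ler_wpM2l// divr_ge0// ltW.
have -> : rho / (1 - rho) * (kap / rho - 1) = - ((1 - kap) / (1 - rho) - 1).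
  by field; rewrite !gt_eqF.
lra.
Qed.

(** All the steps use the tangent line at the same point [ln rho], of slope [- w]. The corrections
    therefore add up to [- w (sum ln (k i) - t ln rho) <= 0], whatever the individual [k i]. *)
Lemma linear_rate C k rho t : (forall i, 0 < C i) -> (forall i, 0 < k i) ->
  0 < rho < 1 -> (forall i, C i.+1 <= (1 - k i) * C i) ->
  t%:R * ln rho <= \sum_(i < t) ln (k i) ->
  C t <= (1 - rho) ^+ t * C 0%N.
Proof.
move=> C0 k0 rho01 Ck sum_ge.
have k1 i : k i < 1.
  have := lt_le_trans (C0 i.+1) (Ck i); rewrite pmulr_lgt0//; lra.
have /andP[r0 r1] := rho01.
have r1' : 0 < 1 - rho by lra.
pose w := rho / (1 - rho).
have step m : ln (C m) <= ln (C 0%N) + m%:R * ln (1 - rho)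
     - w * (\sum_(i < m) ln (k i) - m%:R * ln rho).
  elim: m => [|m IH]; first by rewrite big_ord0 !mul0r subrr mulr0 subr0 addr0.
  have : ln (C m.+1) <= ln (1 - k m) + ln (C m).
    by rewrite -lnM ?posrE ?subr_gt0// ler_ln ?posrE// mulr_gt0 ?subr_gt0.
  have := @ln1B_le (k m) rho; rewrite k0 k1 => /(_ isT rho01); rewrite -/w.
  rewrite big_ord_recr/= -natr1.
  move: IH; set S := \sum_(i < m) _; set lm := ln (k m).
  move=> IH H1 H2; lra.
have {}step : ln (C t) <= ln (C 0%N) + t%:R * ln (1 - rho).
  apply: le_trans (step t) _; rewrite gerBl mulr_ge0 ?subr_ge0//.
  by rewrite divr_ge0// ltW.
rewrite -ler_ln ?posrE ?mulr_gt0 ?exprn_gt0// lnM ?posrE ?exprn_gt0//.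
by rewrite lnXn// -mulr_natl addrC.
Qed.

(** Terms before the cutoff [N] count as [D], later ones as a geometric tail. The induction carries
    the exact partial geometric sum, together with the crude bound [t D] needed before the
    cutoff. *)
Lemma sum_le_cutoff_geometric a (D N h : R) t : 0 <= D -> 0 <= N -> 0 < h <= 1 ->
  (forall i, a i <= D) -> (forall i, N <= i%:R -> a i <= (1 - h) ^+ i * D) ->
  \sum_(i < t) a i <= D * (N + h^-1).
Proof.
move=> D0 N0 /andP[h0 h1] aD aN.
have h1' : 0 <= 1 - h by lra.
have p0 m : 0 <= (1 - h) ^+ m by exact: exprn_ge0.
suff [_ H] : \sum_(i < t) a i <= t%:R * D /\
    \sum_(i < t) a i <= D * (N + (1 - (1 - h) ^+ t) / h).
  apply: (le_trans H); rewrite ler_wpM2l// lerD2l ler_pdivrMr// mulVf ?gt_eqF//.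
  by rewrite gerBl.
elim: t => [|t [IH1 IH2]].
  by rewrite big_ord0 mul0r expr0 subrr mul0r addr0 mulr_ge0.
rewrite big_ord_recr/=; split; first by rewrite -natr1 mulrDl mul1r lerD.
have [Nt|tN] := leP N t%:R.
  apply: le_trans (lerD IH2 (aN _ Nt)) _.
  rewrite exprS; set q := (1 - h) ^+ t.
  have -> : D * (N + (1 - (1 - h) * q) / h) = D * (N + (1 - q) / h) + q * D.
    by field; rewrite gt_eqF.
  exact: lexx.
(* As [N] need not be an integer, up to [N + 1] terms may precede the cutoff; the extra 1 is paid by
   the first term of the geometric sum. *)
have : t%:R * D + D <= D * (N + 1).
  by have := ler_wpM2l D0 (ltW tN); lra.
have : D * (N + 1) <= D * (N + (1 - (1 - h) ^+ t.+1) / h).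
  rewrite ler_wpM2l// lerD2l ler_pdivlMr// mul1r lerBrDl -lerBrDr.
  by rewrite exprS ler_piMr// exprn_ile1//; lra.
by have := aD t; lra.
Qed.

End Scalars.

(** As [B s = - eta g], with [p = - g^T s] the product of [|g|^2] and the ratio collapses to
    [p^2 / s^T y], for every weight [W]. Armijo gives a decrease of [alpha p], and the curvature
    condition gives [s^T y >= (1 - beta) p]. *)
Lemma armijo_wolfe_step (R : realType) (d : nat) (f : 'cV[R]_d -> R)
    (alpha beta eta : R) (x s y : 'cV[R]_d) (B W : 'M[R]_d) :
  pdmx B -> pdmx W -> grad f x != 0 -> 0 < alpha -> beta < 1 -> 0 < eta ->
  armijo_wolfe alpha beta f x (bfgs_dir f B x) eta ->
  s = eta *: bfgs_dir f B x -> y = grad f (x + s) - grad f x ->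
  [/\ s != 0, 0 < dotv s y &
      f (x + s) <= f x - alpha * (1 - beta) *
        (qform W (grad f x) * (qform B s ^+ 2 / (qform W (B *m s) * dotv s y)))].
Proof.
move=> Bp Wp g0 al0 be1 eta0 [arm wol] sE yE.
have Bu := pdmx_unitmx Bp.
move gE : (grad f x) g0 => g g0.
have BsE : B *m s = - (eta *: g).
  by rewrite sE -scalemxAr /bfgs_dir gE mulmxN mulKVmx// scalerN.
pose p := - dotv g s.
have pE : eta * dotv g (bfgs_dir f B x) = - p by rewrite /p opprK sE dotvZr.
have p0 : 0 < p.
  have := (pdmx_inv Bp).2 g g0.
  rewrite /p sE dotvZr /bfgs_dir gE dotvNr mulrN opprK => q0.
  by rewrite mulr_gt0.
have s0 : s != 0.
  by apply/negP => /eqP s0; move: p0; rewrite /p s0 dotv0 oppr0 ltxx.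
have G0 : 0 < qform W g by exact: Wp.2.
have syp : (1 - beta) * p <= dotv s y.
  move: wol; rewrite -sE gE => /(ler_wpM2l (ltW eta0)).
  rewrite mulrCA pE -dotvZr -sE => wol.
  rewrite yE gE dotvDr dotvNr [dotv s g]dotvC [dotv s _]dotvC.
  rewrite /p in wol *; lra.
have sy0 : 0 < dotv s y by apply: lt_le_trans syp; rewrite mulr_gt0// subr_gt0.
split=> //.
have -> : qform B s = eta * p by rewrite /qform BsE dotvNr dotvZr dotvC -mulrN.
have -> : qform W (B *m s) = eta ^+ 2 * qform W g by rewrite BsE qformN qformZ.
have -> : qform W g * ((eta * p) ^+ 2 / (eta ^+ 2 * qform W g * dotv s y)) =
    p ^+ 2 / dotv s y by field; rewrite !gt_eqF.
move: arm; rewrite -sE gE -mulrA pE => arm; apply: (le_trans arm).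
rewrite mulrN lerD2l lerN2 -mulrA (ler_wpM2l (ltW al0))//.
rewrite mulrA ler_pdivrMr// expr2 mulrA [leRHS]mulrC.
by rewrite ler_wpM2r// ltW.
Qed.

(** * Estimates along a BFGS run, and its two phases *)

Section Run.
Context {R : realType} {n : nat}.
Variables (f : 'cV[R]_n.+1 -> R) (M : R) (xs : 'cV[R]_n.+1) (alpha beta : R).
Variables (x : nat -> 'cV[R]_n.+1) (B : nat -> 'M[R]_n.+1) (eta : nat -> R).
Hypothesis f_diff : twice_differentiable f.
Hypothesis f_convex : strictly_convex f.
Hypothesis M_gt0 : 0 < M.
Hypothesis f_ssc : strongly_self_concordant M f.
Hypothesis xs_min : is_minimizer f xs.
Hypothesis alpha_gt0 : 0 < alpha.
Hypothesis alpha_lt_beta : alpha < beta.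
Hypothesis beta_lt1 : beta < 1.
Hypothesis alpha_lt_half : alpha < 1 / 2.
Hypothesis B0_pd : pdmx (B 0%N).
Hypothesis xB_run : bfgs_run f x B eta.
Hypothesis eta_aw :
  forall t, armijo_wolfe alpha beta f (x t) (bfgs_dir f (B t) (x t)) (eta t).
Hypothesis grad_neq0 : forall t, grad f (x t) != 0.

Let T := invsqrtmx (hess f xs).
Let C t := f (x t) - f xs.
Let D t := Dgap M (C t).
Let s t := x t.+1 - x t.
Let y t := grad f (x t.+1) - grad f (x t).
Let r t := qform (B t) (s t) ^+ 2 / (qform (T *m T) (B t *m s t) * dotv (s t) (y t)).
(** At [t = 0], the scale [c = 1] gives the potential of [tB0] and [c = (1 + D 0)^-1] that of
    [bB0]. *)
Let PsiB c t := Psi (c *: (T *m B t *m T)).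

Lemma weight_inv : T *m T = invmx (hess f xs).
Proof. by case: (invsqrtmxP (f_convex xs)). Qed.

Lemma weight_pd : pdmx (T *m T).
Proof. by rewrite weight_inv; exact/pdmx_inv/f_convex. Qed.

(** Positivity of [B t] is assumed because [bfgs_pd] derives it by induction from the curvature
    inequality [0 < dotv (s t) (y t)] obtained here. *)
Lemma bfgs_step t : pdmx (B t) -> [/\ s t != 0, 0 < dotv (s t) (y t) &
  C t.+1 <= C t - alpha * (1 - beta) * (qform (T *m T) (grad f (x t)) * r t)].
Proof.
move=> Bp; have [eta0 xE _] := xB_run t.
have sE : s t = eta t *: bfgs_dir f (B t) (x t) by rewrite /s xE addrAC subrr add0r.
have xsE : x t.+1 = x t + s t by rewrite /s addrCA subrr addr0.
have yE : y t = grad f (x t + s t) - grad f (x t) by rewrite -xsE.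
have [s0 sy0 dec] := armijo_wolfe_step Bp weight_pd (grad_neq0 t) alpha_gt0 beta_lt1
  eta0 (eta_aw t) sE yE.
by split=> //; rewrite /C /r addrAC lerD2r xsE.
Qed.

Lemma bfgs_pd t : pdmx (B t).
Proof.
elim: t => [//|t Bp]; have [s0 sy0 _] := bfgs_step Bp.
by have [_ _ ->] := xB_run t; exact: pdmx_bfgs_update.
Qed.

Lemma weight_grad_gt0 t : 0 < qform (T *m T) (grad f (x t)).
Proof. exact: (weight_pd.2 _ (grad_neq0 t)). Qed.

Lemma r_gt0 t : 0 < r t.
Proof.
have [s0 sy0 _] := bfgs_step (bfgs_pd t).
have Bs0 : B t *m s t != 0.
  apply: contraNneq s0 => /(congr1 (mulmx (invmx (B t)))).
  by rewrite mulKmx ?mulmx0 => [->//|]; exact/pdmx_unitmx/bfgs_pd.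
rewrite /r divr_gt0 ?exprn_gt0 ?mulr_gt0//; first exact: (bfgs_pd t).2.
exact: weight_pd.2.
Qed.

Lemma gap_decr t : C t.+1 < C t.
Proof.
have [_ _ dec] := bfgs_step (bfgs_pd t); apply: le_lt_trans dec _.
rewrite gtrBl; apply: mulr_gt0; first by apply: mulr_gt0; rewrite ?subr_gt0.
exact: mulr_gt0 (weight_grad_gt0 t) (r_gt0 t).
Qed.

Lemma gap_gt0 t : 0 < C t.
Proof. by apply: le_lt_trans (gap_decr t); rewrite subr_ge0. Qed.

Lemma D_ge0 t : 0 <= D t.
Proof. exact/Dgap_ge0/ltW/gap_gt0. Qed.

Lemma D_decr t : D t.+1 <= D t.
Proof.
rewrite -[D t]mul1r; apply: Dgap_scale; rewrite ?ler01 ?lexx ?(ltW (gap_gt0 _))//.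
by rewrite expr1n mul1r ltW// gap_decr.
Qed.

Lemma D_le_D0 t : D t <= D 0%N.
Proof. by elim: t => // t; apply: le_trans; exact: D_decr. Qed.

Lemma near_min t : M * local_norm f xs (x t - xs) <= D t.
Proof. exact: local_norm_le_Dgap. Qed.

Lemma gap_le t : C t <= (1 + D t) / 2 * qform (T *m T) (grad f (x t)).
Proof.
rewrite weight_inv; apply: gap_le_grad => //; first by rewrite ltr_wpDr ?D_ge0.
move=> u v u01; apply: hess_ge_min => //; apply: local_norm_segment => //.
  exact: near_min.
by rewrite subrr /local_norm /qform mulmx0 dotv0 sqrtr0 mulr0 D_ge0.
Qed.

Lemma grad_diff_ratio t :
  qform (T *m T) (y t) <= (1 + D t) * dotv (s t) (y t).
Proof.
have xsE : x t.+1 = x t + s t by rewrite /s addrCA subrr addr0.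
rewrite weight_inv /y xsE; apply: grad_diff_le => //; first by rewrite ltr_wpDr ?D_ge0.
move=> u v u01; apply: hess_le_min => //; apply: local_norm_segment => //.
  exact: near_min.
exact: le_trans (near_min _) (D_decr t).
Qed.

Lemma gap_rate t : C t.+1 <= (1 - 2 * alpha * (1 - beta) * r t / (1 + D t)) * C t.
Proof.
have [_ _ dec] := bfgs_step (bfgs_pd t); apply: le_trans dec _.
have D1 : 0 < 1 + D t by rewrite ltr_wpDr ?D_ge0.
rewrite mulrBl mul1r lerD2l lerN2.
have -> : 2 * alpha * (1 - beta) * r t / (1 + D t) * C t =
  alpha * (1 - beta) * (2 / (1 + D t) * C t * r t) by field; rewrite gt_eqF.
have ab : 0 <= alpha * (1 - beta).
  by rewrite mulr_ge0 ?subr_ge0 ?(ltW alpha_gt0) ?(ltW beta_lt1).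
rewrite (ler_wpM2l ab)// (ler_wpM2r (ltW (r_gt0 t)))//.
rewrite mulrC mulrA ler_pdivrMr//.
have := gap_le t; lra.
Qed.

(** [Psi_bfgs_update] is telescoped with [|y|^2 / s^T y <= 1 + D i], and the final potential, being
    nonnegative, is dropped. *)
Lemma sum_ln_r_ge c t : 0 < c ->
  \sum_(i < t) (1 - c * (1 + D i)) - PsiB c 0%N <= \sum_(i < t) ln (r i / c).
Proof.
move=> c0; have [Tu TT _] := invsqrtmxP (f_convex xs).
suff : \sum_(i < t) (1 - c * (1 + D i)) - PsiB c 0%N + PsiB c t
    <= \sum_(i < t) ln (r i / c).
  have : 0 <= PsiB c t.
    exact: (pdmx_Psi (pdmx_scaled_conj Tu TT c0 (bfgs_pd t))).2.
  lra.
elim: t => [|t IH]; first by rewrite !big_ord0 sub0r addNr.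
rewrite !big_ord_recr/=.
have [s0 sy0 _] := bfgs_step (bfgs_pd t).
have := Psi_bfgs_update Tu TT c0 (bfgs_pd t) s0 sy0.
have [_ _ BE] := xB_run t; rewrite -[bfgs_update _ _ _]BE.
rewrite -/(PsiB c t.+1) -/(PsiB c t) -/(r t).
have : c * qform (T *m T) (y t) / dotv (s t) (y t) <= c * (1 + D t).
  by rewrite ler_pdivrMr// -mulrA (ler_wpM2l (ltW c0))// grad_diff_ratio.
move: IH; lra.
Qed.

Let ab := alpha * (1 - beta).

Lemma ab_bounds : 0 < ab /\ ab < 1 / 2.
Proof.
have ab0 : 0 < ab by rewrite mulr_gt0// subr_gt0.
split=> //; suff h : ab < alpha by exact: lt_trans h alpha_lt_half.
by rewrite /ab mulrBr mulr1 gtrBl mulr_gt0// (lt_trans alpha_gt0).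
Qed.

(** With this scale each [1 - c (1 + D i)] is nonnegative, so the sum of [ln (r i / c)] is at least
    [- PsiB c 0 >= - t]. *)
Lemma initial_phase t : PsiB (1 + D 0%N)^-1 0%N <= t%:R ->
  C t <= (1 - 2 * ab / (3 * (1 + D 0%N) ^+ 2)) ^+ t * C 0%N.
Proof.
set c := (1 + D 0%N)^-1 => Psi_le; have [ab0 ab1] := ab_bounds.
have D1 : 0 < 1 + D 0%N by rewrite ltr_wpDr ?D_ge0.
have c0 : 0 < c by rewrite invr_gt0.
have c1 : c <= 1 by rewrite invf_le1// lerDl D_ge0.
(* Chosen so that [K (r i / c)] is the coefficient of [gap_rate] with [D i] replaced by [D 0]. *)
pose K := 2 * ab * c ^+ 2.
have ab2 : 0 < 2 * ab by exact: mulr_gt0.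
have K0 : 0 < K by apply: mulr_gt0 => //; exact: exprn_gt0.
have K1 : K < 1.
  have : K <= 2 * ab * 1.
    by rewrite (ler_wpM2l (ltW ab2))// exprn_ile1// ltW.
  by lra.
have -> : 2 * ab / (3 * (1 + D 0%N) ^+ 2) = K / 3.
  by rewrite /K /c; field; rewrite gt_eqF.
apply: (linear_rate (k := fun i => K * (r i / c))).
- exact: gap_gt0.
- by move=> i; apply: mulr_gt0 => //; exact: divr_gt0 (r_gt0 i) _.
- by rewrite divr_gt0//=; lra.
- move=> i; apply: le_trans (gap_rate i) _.
  rewrite (ler_wpM2r (ltW (gap_gt0 i)))// lerD2l lerN2.
  have Di : 0 < 1 + D i by rewrite ltr_wpDr ?D_ge0.
  have -> : K * (r i / c) = 2 * alpha * (1 - beta) * r i / (1 + D 0%N).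
    by rewrite /K /c /ab; field; rewrite gt_eqF.
  rewrite ler_wpM2l//; last by rewrite lef_pV2 ?posrE// lerD2l D_le_D0.
  by rewrite ltW// mulr_gt0 ?r_gt0// mulr_gt0 ?subr_gt0// mulr_gt0.
have lnE (i : 'I_t) : ln (K * (r i / c)) = ln K + ln (r i / c).
  by rewrite lnM ?posrE// divr_gt0// r_gt0.
rewrite (eq_bigr _ (fun i _ => lnE i)) big_split/= sumr_const card_ord.
rewrite ln_div ?posrE// -[ln K *+ t]mulr_natl mulrBr lerD2l.
apply: le_trans (sum_ln_r_ge t c0).
have : 0 <= \sum_(i < t) (1 - c * (1 + D i)).
  apply: sumr_ge0 => i _; rewrite subr_ge0 /c mulrC ler_pdivrMr// mul1r lerD2l.
  exact: D_le_D0.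
have : t%:R <= t%:R * ln 3 :> R by rewrite ler_peMr// ln3_ge1.
lra.
Qed.

Lemma sum_D_le t : \sum_(i < t) D i <=
  D 0%N * (PsiB (1 + D 0%N)^-1 0%N + 3 * (1 + D 0%N) ^+ 2 / ab).
Proof.
have [ab0 ab1] := ab_bounds; have [Tu TT _] := invsqrtmxP (f_convex xs).
have D1 : 1 <= 1 + D 0%N by rewrite lerDl D_ge0.
have D1' : 0 < 1 + D 0%N by apply: lt_le_trans D1.
(* Half the rate of the initial phase: [1 - 2 h <= (1 - h)^2] bounds the gap by [(1 - h)^(2 i) C 0],
   hence [D i] by [(1 - h)^i D 0]. *)
pose h := ab / (3 * (1 + D 0%N) ^+ 2).
have D2 : 1 <= (1 + D 0%N) ^+ 2 by exact: exprn_ege1.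
have h0 : 0 < h by rewrite divr_gt0// mulr_gt0// exprn_gt0.
have h1 : h <= 1 by rewrite ler_pdivrMr ?mul1r ?mulr_gt0 ?exprn_gt0//; lra.
have -> : 3 * (1 + D 0%N) ^+ 2 / ab = h^-1 by rewrite /h invf_div.
apply: sum_le_cutoff_geometric; rewrite ?D_ge0 ?h0 ?h1//.
- apply: (pdmx_Psi (pdmx_scaled_conj Tu TT _ B0_pd)).2; by rewrite invr_gt0.
- exact: D_le_D0.
move=> i /initial_phase Ci; have h1' : 0 <= 1 - h by rewrite subr_ge0.
apply: Dgap_scale; rewrite ?(ltW (gap_gt0 _))//.
  by rewrite exprn_ge0//= exprn_ile1// gerBl ltW.
apply: (le_trans Ci); rewrite (ler_wpM2r (ltW (gap_gt0 0)))// -exprM mulnC exprM.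
have hE : 2 * ab / (3 * (1 + D 0%N) ^+ 2) = 2 * h by rewrite /h mulrA.
have h2 : 2 * h <= 1.
  by rewrite -hE ler_pdivrMr ?mul1r ?mulr_gt0 ?exprn_gt0//; lra.
rewrite hE lerXn2r ?nnegrE ?exprn_ge0 ?subr_ge0//.
by have := sqr_ge0 h; lra.
Qed.

(** The logarithms of [r i] cost at most [PsiB 1 0] plus the sum of the [D i], and the factors
    [1 + D i] cost that sum once more through [ln (1 + D i) <= D i]. The total is at most
    [t <= t ln 3]. *)
Lemma main_phase t :
  PsiB 1 0%N + 3 * (\sum_(i < t) D i) <= t%:R ->
  C t <= (1 - 2 * ab / 3) ^+ t * C 0%N.
Proof.
move=> t_ge; have [ab0 ab1] := ab_bounds.
have D1 i : 0 < 1 + D i by rewrite ltr_wpDr ?D_ge0.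
apply: (linear_rate (k := fun i => 2 * ab * (r i / (1 + D i)))).
- exact: gap_gt0.
- by move=> i; apply: mulr_gt0; [exact: mulr_gt0|exact: divr_gt0 (r_gt0 i) _].
- by lra.
- move=> i; apply: le_trans (gap_rate i) _.
  rewrite (ler_wpM2r (ltW (gap_gt0 i)))// lerD2l lerN2 /ab.
  by rewrite !mulrA.
have lnE (i : 'I_t) :
    ln (2 * ab * (r i / (1 + D i))) = ln (2 * ab) + (ln (r i / 1) - ln (1 + D i)).
  have ri0 := r_gt0 i; have ab2 : 0 < 2 * ab by exact: mulr_gt0.
  move: (r i) (2 * ab) (1 + D i) (D1 i) ri0 ab2 => u v w w0 u0 v0.
  by rewrite divr1 -ln_div ?posrE// lnM ?posrE// divr_gt0.
rewrite (eq_bigr _ (fun i _ => lnE i)) big_split/= sumr_const card_ord.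
have ab2 : 0 < 2 * ab by exact: mulr_gt0.
rewrite -[ln (2 * ab) *+ t]mulr_natl [ln (2 * ab / 3)]ln_div ?posrE//.
rewrite mulrBr lerD2l sumrB.
have := sum_ln_r_ge t ltr01.
have -> : \sum_(i < t) (1 - 1 * (1 + D i)) = - \sum_(i < t) D i.
  by rewrite -sumrN; apply: eq_bigr => i _; ring.
have : \sum_(i < t) ln (1 + D i) <= \sum_(i < t) D i.
  apply: ler_sum => i _; apply: le_ln1Dx; exact: lt_le_trans (D_ge0 i).
have : 0 <= \sum_(i < t) D i by apply: sumr_ge0 => i _; exact: D_ge0.
have : t%:R <= t%:R * ln 3 :> R by rewrite ler_peMr// ln3_ge1.
lra.
Qed.

End Run.

Theorem theorem3p3 (R : realType) (d : nat) (f : 'cV[R]_d -> R) (M : R)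
    (xs : 'cV[R]_d) (alpha beta : R)
    (x : nat -> 'cV[R]_d) (B : nat -> 'M[R]_d) (eta : nat -> R)
    (f_diff : twice_differentiable f)
    (f_convex : strictly_convex f)
    (M_gt0 : 0 < M)
    (f_ssc : strongly_self_concordant M f)
    (xs_min : is_minimizer f xs)
    (alpha_gt0 : 0 < alpha) (alpha_lt_beta : alpha < beta)
    (beta_lt1 : beta < 1) (alpha_lt_half : alpha < 1 / 2)
    (B0_pd : pdmx (B 0%N))
    (xB_run : bfgs_run f x B eta)
    (eta_aw : forall t, armijo_wolfe alpha beta f (x t)
                          (bfgs_dir f (B t) (x t)) (eta t))
    (grad_neq0 : forall t, grad f (x t) != 0) :
  let D0 := Dgap M (f (x 0%N) - f xs) in
  let Hs := invsqrtmx (hess f xs) in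
  let tB0 := Hs *m B 0%N *m Hs in
  let bB0 := (1 + D0)^-1 *: tB0 in
  forall t : nat, (1 <= t)%N ->
    t%:R >= Psi tB0 + 3 * D0 * (Psi bB0
              + 3 * (1 + D0) ^+ 2 / (alpha * (1 - beta))) ->
    (f (x t) - f xs) / (f (x 0%N) - f xs)
      <= (1 - 2 * alpha * (1 - beta) / 3) ^+ t.
Proof.
case: d f xs x B f_diff f_convex f_ssc xs_min B0_pd xB_run eta_aw grad_neq0.
  (* In dimension 0 every gradient is zero, against [grad_neq0]; the spectral lemmas cover dimension
     [n.+1]. *)
  move=> f xs x B _ _ _ _ _ _ _ /(_ 0%N)/eqP[].
  by apply/matrixP => -[].
move=> n f xs x B f_diff f_convex f_ssc xs_min B0_pd xB_run eta_aw grad_neq0.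
move=> D0 Hs tB0 bB0 t _ t_ge.
have C0_gt0 : 0 < f (x 0%N) - f xs.
  exact: (@gap_gt0 R n f xs alpha beta x B eta).
rewrite ler_pdivrMr// -(mulrA 2).
apply: (@main_phase R n f M xs alpha beta x B eta) => //.
rewrite scale1r; apply: le_trans t_ge.
rewrite lerD2l -mulrA ler_pM2l//.
exact: (@sum_D_le R n f M xs alpha beta x B eta).
Qed.
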